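(* There is an absolute constant $C>0$ such that for every positive integer $n$, $f(5,n)\le C n^{-4/3}$.
   Context: For positive integers $k,n$, $f(k,n)$ denotes the smallest non-zero value of $|z_1+\cdots+z_k|$, where $z_1,\dots,z_k$ range over complex $n$th roots of unity (repetitions allowed), i.e. $f(k,n)=\min\{|z_1+\cdots+z_k| : z_j^n=1 \text{ for all } j,\ z_1+\cdots+z_k\neq 0\}$. *)

(* Defs.v *)
From HB Require Import structures.
From mathcomp Require Import all_boot all_order all_algebra.
From mathcomp Require Import all_classical all_reals all_analysis.
From mathcomp Require Import complex.

Set Implicit Arguments.
Unset Strict Implicit.
Unset Printing Implicit Defensive.

Import Order.TTheory GRing.Theory Num.Theory.
Local Open Scope classical_set_scope.
Local Open Scope ring_scope.

(* The modulus is taken with [normc : R[i] -> R], because the generic norm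
   [`|z|] on [R[i]] is itself an element of [R[i]]. *)
Definition rootsum_moduli (R : realType) (k n : nat) : set R :=
  [set x | exists z : 'I_k -> R[i],
     [/\ forall j, z j ^+ n = 1, \sum_(j < k) z j != 0
       & x = Normc.normc (\sum_(j < k) z j)]].
Arguments rootsum_moduli R k n : clear implicits.

(* For positive k and n this infimum is a minimum: see [min_rootsum_is_min]. *)
Definition min_rootsum (R : realType) (k n : nat) : R :=
  inf (rootsum_moduli R k n).
Arguments min_rootsum R k n : clear implicits.

Lemma min_rootsum_is_min (R : realType) (k n : nat) : (0 < k)%N -> (0 < n)%N ->
  rootsum_moduli R k n (min_rootsum R k n) /\
  lbound (rootsum_moduli R k n) (min_rootsum R k n).
Proof.
move=> k0 n0.
suff [m mS mlb] : exists2 m, rootsum_moduli R k n m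
    & lbound (rootsum_moduli R k n) m.
  suff -> : min_rootsum R k n = m by [].
  apply/le_anti/andP; split.
    by apply: ge_inf => //; exists m.
  by apply: lb_le_inf => //; exists m.
have [rs rsE] := closed_field_poly_normal ('X^n - 1%:P : {poly R[i]}).
have rsP (w : R[i]) : (w \in rs) = (w ^+ n == 1).
  have -> : (w \in rs) = root ('X^n - 1%:P) w.
    rewrite rsE rootZ ?root_prod_XsubC //.
    by rewrite lead_coef_eq0 -size_poly_eq0 size_XnsubC.
  by rewrite rootE !hornerE subr_eq0.
have rs1 : 1 \in rs by rewrite rsP expr1n.
pose T := {ffun 'I_k -> seq_sub rs}.
pose S (t : T) : R[i] := \sum_(j < k) ssval (t j).
have t0P : S [ffun=> SeqSub rs1] != 0.
  rewrite /S (eq_bigr (fun=> 1)) => [|j _]; last by rewrite ffunE.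
  by rewrite sumr_const card_ord pnatr_eq0 -lt0n.
have [t tP tmin] := arg_minP (P := fun t => S t != 0)
  (fun t => Normc.normc (S t)) t0P.
exists (Normc.normc (S t)).
  exists (fun j => ssval (t j)); split => // j.
  by apply/eqP; rewrite -rsP; exact: ssvalP.
move=> _ [z [z1 zn0 ->]].
have zrs j : z j \in rs by rewrite rsP z1.
have zE : \sum_(j < k) z j = S [ffun j => SeqSub (zrs j)].
  by apply: eq_bigr => j _; rewrite ffunE.
by rewrite zE; apply: tmin; rewrite -zE.
Qed.

(* Main.v *)
(** Perturb the vertices of a regular pentagon symmetrically: for integers [a]
    and [b] the sum of [1], [exp (± 2 i pi a / n)] and [exp (± 2 i pi b / n)] is
    the real number [F = 1 + 2 cos (2 pi a / n) + 2 cos (2 pi b / n)]. Put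
    [a = n / 5 + x], [b = 2 n / 5 + y], [t = 2 pi / n] and
    [tau = 2 cos (2 pi / 5)], the inverse of the golden ratio [1 + tau]. Then
    [F = - 2 t sin (2 pi / 5) (x + tau y) + O(t^2 (x^2 + y^2))].
    Scaling by units of [Z[tau]] gives, for each power [q] of the golden ratio,
    a choice of [a] and [b] with [|x + tau y|] between [1 / q] and [5 / q] and
    with [x] and [y] of size [O(q)]. Taking [q] to be a small multiple of
    [n^(1/3)], the linear term dominates: it makes [F] nonzero and of order
    [t / q], that is [n^(-4/3)]. *)

Require Import Defs.
From HB Require Import structures.
From mathcomp Require Import all_boot all_order all_algebra.
From mathcomp Require Import all_classical all_reals all_analysis.
From mathcomp Require Import complex.
From mathcomp Require Import ring lra.

Import Order.TTheory GRing.Theory Num.Theory.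
Local Open Scope ring_scope.

(** * Trigonometric estimates and the regular pentagon *)

Lemma sin_lipschitz_le {R : realType} (a b : R) : a <= b ->
  `|sin b - sin a| <= b - a.
Proof.
move=> ab.
have [x _ ->] : exists2 c, c \in `[a, b] & sin b - sin a = cos c * (b - a).
  apply: (@MVT_segment R (@sin R) (@cos R)) => //.
  by apply: derivable_within_continuous => x _; exact: derivable_sin.
by rewrite normrM [`|b - a|]ger0_norm ?subr_ge0// ler_piMl ?subr_ge0// cos_max.
Qed.

(** Mean value theorem for [cos x + x * sin a], whose derivative [sin a - sin x] is bounded by the
    Lipschitz estimate for [sin]. *)
Lemma cos_taylor1 {R : realType} (a b : R) :
  `|cos b - cos a + (b - a) * sin a| <= (b - a) ^+ 2.
Proof.
wlog ab : a b / a <= b => [H|].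
  have [/H//|/ltW ba] := leP a b.
  have := H (- a) (- b); rewrite lerN2 !cosN sinN => /(_ ba).
  by congr (`|_| <= _); ring.
pose f (x : R) : R := cos x + x * sin a.
have fd (x : R) : is_derive x 1 f (- sin x + sin a).
  rewrite /f; apply: is_derive_eq.
  by rewrite /GRing.scale /=; ring.
have [c] : exists2 c, c \in `[a, b] & f b - f a = (- sin c + sin a) * (b - a).
  apply: (@MVT_segment R f (fun x => - sin x + sin a)) => //.
  by apply: derivable_within_continuous => x _; exact: (@ex_derive _ _ _ _ _ _ _ (fd x)).
rewrite in_itv /= => /andP[ac cb] E.
have -> : cos b - cos a + (b - a) * sin a = (- sin c + sin a) * (b - a).
  by rewrite -E /f; ring.
rewrite expr2 normrM [`|b - a|]ger0_norm ?subr_ge0// ler_wpM2r ?subr_ge0//.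
rewrite addrC distrC (le_trans (sin_lipschitz_le _ _ ac))//; lra.
Qed.

Lemma pentagon_angle {R : realType} : let th : R := 2 * pi / 5 in
  [/\ 0 < cos th, (2 * cos th) ^+ 2 + 2 * cos th = 1, 1 / 2 <= sin th <= 1,
      1 + 2 * cos th + 2 * cos (2 * th) = 0
    & sin (2 * th) = 2 * cos th * sin th].
Proof.
move=> th.
have pi0 := pi_gt0 R.
have c0 : 0 < cos th.
  by apply: cos_gt0_pihalf; rewrite /th; lra.
have s0 : 0 < sin th.
  by apply: sin_gt0_pihalf; rewrite /th; lra.
have s2 : sin (2 * th) = 2 * cos th * sin th.
  by rewrite mulr_natl sin_mulr2n; ring.
have c2 : cos (2 * th) = 2 * cos th ^+ 2 - 1.
  by rewrite mulr_natl cos_mulr2n; ring.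
have cs := cos2Dsin2 th.
have c1 : cos th != 1.
  by apply/negP => /eqP e; move: cs; rewrite e; nra.
have key : (2 * cos th) ^+ 2 + 2 * cos th = 1.
  (* [2 th] and [3 th] are opposite modulo [2 pi] *)
  have e : cos (2 * th) = cos (2 * th + th).
    have -> : 2 * th + th = - (2 * th) + pi *+ 2 by rewrite /th; field.
    by rewrite cosD2pi cosN.
  move: e; rewrite cosD s2 c2 => e.
  (* [e] is a cubic equation in [cos th] with the spurious root [1]; splitting off that root leaves
     the golden quadratic. *)
  have e' : (cos th - 1) * ((2 * cos th) ^+ 2 + 2 * cos th - 1) = 0.
    have -> : (cos th - 1) * ((2 * cos th) ^+ 2 + 2 * cos th - 1) =
      (2 * cos th ^+ 2 - 1) * cos th - 2 * cos th * (1 - cos th ^+ 2)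
      - (2 * cos th ^+ 2 - 1) by ring.
    by rewrite -sin2cos2; lra.
  by move/eqP: e'; rewrite mulf_eq0 subr_eq0 (negPf c1) /= => /eqP; lra.
split => //; last by rewrite c2; lra.
by apply/andP; split; nra.
Qed.

(** * Approximation at the scale of a golden power *)

(* Inhomogeneous approximation in [Z[tau]]; [x - (1 + tau) * y] is the Galois
   conjugate of [x + tau * y]. The induction multiplies by the unit [1 + tau],
   which sends the coordinates [(x, y)] to [(x + y, x)]. *)
Lemma golden_inhomogeneous {R : archiRealFieldType} (tau : R) (k : nat) (X Y : R) :
  0 < tau -> tau ^+ 2 + tau = 1 ->
  exists a b : int, let x := a%:~R - X in let y := b%:~R - Y in
    [/\ 1 <= (1 + tau) ^+ k * `|x + tau * y|,
        (1 + tau) ^+ k * `|x + tau * y| <= 5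
      & `|x - (1 + tau) * y| <= 5 * (1 + tau) ^+ k].
Proof.
move=> t0 tE; elim: k X Y => [|k IH] X Y.
  (* The shift by 3 puts [x] in [(2, 3]] while [y] lies in [(-1, 0]], so both linear forms are
     positive and between 1 and 5. *)
  exists (Num.floor X + 3), (Num.floor Y); move=> x y.
  have /andP[] := floor_itv X; have /andP[] := floor_itv Y.
  rewrite /x /y !intrD /=.
  set A := (Num.floor X)%:~R; set B := (Num.floor Y)%:~R => y1 y2 x1 x2.
  have ty : 0 <= tau * (Y - B) <= tau.
    apply/andP; split; first by apply: mulr_ge0; lra.
    by rewrite ler_piMr; lra.
  have t1 : tau < 2 / 3 by nra.
  rewrite expr0 !mul1r mulr1.
  rewrite !ger0_norm; [split|..]; move: ty => /andP[]; lra.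
have [a [b /=]] := IH (X + Y) X.
set x := a%:~R - _; set y := b%:~R - X => -[h1 h2 h3].
(* [(b, a - b)] is the preimage of [(a, b)] under the unit: the form shrinks by [1 + tau] and its
   conjugate grows by the same factor, up to sign. *)
exists b, (a - b) => /=; rewrite intrB -/y.
have -> : a%:~R - b%:~R - Y = x - y by rewrite /x /y; ring.
have e1 : (1 + tau) * (y + tau * (x - y)) = x + tau * y.
  have -> : (1 + tau) * (y + tau * (x - y)) =
    (tau ^+ 2 + tau) * (x - y) + y + tau * y by ring.
  by rewrite tE; ring.
have -> : y - (1 + tau) * (x - y) = - ((1 + tau) * (x - (1 + tau) * y)).
  have -> : - ((1 + tau) * (x - (1 + tau) * y)) =
    - (1 + tau) * x + (1 + tau + (tau ^+ 2 + tau)) * y by ring.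
  by rewrite tE; ring.
rewrite normrN normrM !exprSr -mulrA.
have -> : (1 + tau) * `|y + tau * (x - y)| = `|x + tau * y|.
  by rewrite -e1 normrM [`|1 + tau|]gtr0_norm//; lra.
split=> //.
by rewrite gtr0_norm ?mulrA 1?mulrC ?ler_pM2r//; lra.
Qed.

(** Powers of [phi] are unbounded by Bernoulli's inequality; the least exponent whose power exceeds
    [Q] is positive, and [k] is its predecessor. *)
Lemma exp_bracket {R : archiRealFieldType} (phi Q : R) : 3 / 2 <= phi -> 1 <= Q ->
  exists k : nat, phi ^+ k <= Q < phi ^+ k.+1.
Proof.
move=> hphi hQ.
have bern (k : nat) : k%:R / 2 + 1 <= phi ^+ k.
  elim: k => [|k IH]; first by rewrite expr0; lra.
  rewrite exprS -natr1; have : (0 : R) <= k%:R by []; nra.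
have ex : exists k, Q < phi ^+ k.
  exists (2 * Num.bound Q)%N; apply: lt_le_trans (bern _).
  by rewrite natrM; have := archi_boundP (x := Q) ltac:(lra); lra.
have [[|k]] := ex_minnP ex; first by rewrite expr0 => ?; lra.
move=> h1 h2; exists k; rewrite h1 andbT leNgt; apply/negP => /h2.
by rewrite ltnn.
Qed.

(** * Symmetric sums of five roots of unity *)

Definition cis {R : realType} (th : R) : R[i] := (cos th +i* sin th)%C.

Lemma cisX {R : realType} (th : R) n : cis th ^+ n = cis (n%:R * th).
Proof.
elim: n => [|n IH]; first by rewrite mul0r /cis cos0 sin0 expr0.
rewrite exprS IH -natr1 mulrDl mul1r addrC /cis cosD sinD.
by apply/eqP; rewrite eq_complex /=; apply/andP; split; apply/eqP; ring.
Qed.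

Lemma cis_2piM_int {R : realType} (a : int) : cis (2 * pi * a%:~R : R) = 1.
Proof.
have nat_case (m : nat) : cis (2 * pi * m%:R : R) = 1.
  rewrite mulrC -cisX (_ : cis _ = 1) ?expr1n//.
  by rewrite /cis mulr_natl cos2pi sin2pi.
case: a => m; first exact: nat_case.
have := nat_case m.+1.
by rewrite NegzE intrN mulrN /cis cosN sinN => -[-> ->]; rewrite oppr0.
Qed.

Lemma cis_unity_root {R : realType} (n : nat) (a : int) : (0 < n)%N ->
  cis (2 * pi * a%:~R / n%:R : R) ^+ n = 1.
Proof.
move=> n0; rewrite cisX -(cis_2piM_int a) mulrC divfK//.
by rewrite pnatr_eq0 -lt0n.
Qed.

Lemma min_rootsum_ler {R : realType} (k n : nat) (x : R) :
  rootsum_moduli R k n x -> min_rootsum R k n <= x.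
Proof.
apply: ge_inf; exists 0 => _ [z [_ _ ->]].
by case: (\sum_j z j) => u v /=; exact: sqrtr_ge0.
Qed.

Lemma min_rootsum5_symmetric {R : realType} (n : nat) (a b : int) :
  (0 < n)%N ->
  let F : R := 1 + 2 * cos (2 * pi * a%:~R / n%:R)
                 + 2 * cos (2 * pi * b%:~R / n%:R) in
  F != 0 -> min_rootsum R 5 n <= `|F|.
Proof.
move=> n0 F F0.
pose z (c : int) : R[i] := cis (2 * pi * c%:~R / n%:R).
have zn c : z c ^+ n = 1 by exact: cis_unity_root.
have zD c : z c + z (- c) = (2 * cos (2 * pi * c%:~R / n%:R))%:C%C.
  rewrite /z /cis intrN mulrN mulNr cosN sinN.
  by apply/eqP; rewrite eq_complex /=; apply/andP; split; apply/eqP; ring.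
pose w (j : 'I_5) : R[i] := nth 0 [:: 1; z a; z (- a); z b; z (- b)] j.
have wE : \sum_(j < 5) w j = F%:C%C.
  rewrite !big_ord_recl big_ord0 /w /=.
  rewrite addr0 [z a + _]addrA zD zD /F.
  by apply/eqP; rewrite eq_complex /= addrA !addr0 !eqxx.
apply: min_rootsum_ler; exists w; split.
- by move=> [[|[|[|[|[|j]]]]] hj]//; rewrite /w /= ?zn ?expr1n.
- by rewrite wE; apply: contra F0 => /eqP[->].
- by rewrite wE /= expr0n addr0 sqrtr_sqr.
Qed.

Lemma min_rootsum5_le5 {R : realType} (n : nat) :
  (0 < n)%N -> min_rootsum R 5 n <= 5.
Proof.
move=> n0; have := @min_rootsum5_symmetric R n 0 0 n0.
rewrite mulr0 mul0r cos0 /= => /(_ _)/le_trans; apply; first by apply/negP => /eqP; lra.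
by rewrite ger0_norm; lra.
Qed.

(** * Perturbation of the pentagon and choice of the scale *)

(** The constant terms cancel because the pentagon sums to zero, and [sin (2 * th) = tau * sin th]
    merges the two linear terms into one multiple of [x + tau * y]. *)
Lemma pentagon_perturbation {R : realType} (t x y : R) :
  let th : R := 2 * pi / 5 in let tau := 2 * cos th in
  `|1 + 2 * cos (th + t * x) + 2 * cos (2 * th + t * y)
     + 2 * t * sin th * (x + tau * y)| <= 2 * t ^+ 2 * (x ^+ 2 + y ^+ 2).
Proof.
rewrite /=; set th : R := 2 * pi / 5.
have [_ _ _ h0 h2] := @pentagon_angle R; rewrite -/th in h0 h2.
have := cos_taylor1 th (th + t * x).
have := cos_taylor1 (2 * th) (2 * th + t * y).
rewrite h2 ![_ + _ * _ - _]addrAC !subrr !add0r !exprMn.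
set A := _ + t * y * _; set B := _ + t * x * _ => hA hB.
have -> : 1 + 2 * cos (th + t * x) + 2 * cos (2 * th + t * y)
     + 2 * t * sin th * (x + 2 * cos th * y) = 2 * A + 2 * B.
  rewrite -[LHS]subr0 -h0 /A /B; ring.
by move: hA hB; rewrite !ler_norml => /andP[? ?] /andP[? ?]; apply/andP; split; lra.
Qed.

Theorem theorem1p1 (R : realType) :
  exists C : R, 0 < C /\
    forall n : nat, (0 < n)%N ->
      min_rootsum R 5 n <= C * (n%:R `^ (- (4 / 3))).
Proof.
exists (10 ^+ 9); split; first exact: exprn_gt0.
move=> n n0.
have N0 : (0 : R) < n%:R by rewrite ltr0n.
set N : R := n%:R in N0 *.
pose p : R := N `^ 3^-1.
have p0 : 0 < p by exact: powR_gt0.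
have pE : p ^+ 3 = N.
  rewrite -(powR_mulrn 3 (ltW p0)) /p -powRrM mulVf ?powRr1 ?(ltW N0)//.
have -> : N `^ (- (4 / 3)) = (p ^+ 4)^-1.
  by rewrite powRN -powR_mulrn ?(ltW p0)// -powRrM (mulrC (3^-1)).
(* For [p < 100] the trivial bound 5 suffices, as [5 * 100 ^ 4 <= 10 ^ 9]; this case dictates
   [C]. *)
have [psmall|plarge] := ltP p 100.
  apply: (le_trans (min_rootsum5_le5 n n0)).
  rewrite ler_pdivlMr ?exprn_gt0//.
  have : p ^+ 4 <= 100 ^+ 4 by rewrite lerXn2r ?nnegrE ?(ltW p0) ?ltW.
  lra.
have [c0 tauE /andP[s_ge s_le] _ _] := @pentagon_angle R.
set th : R := 2 * pi / 5 in c0 tauE s_ge s_le.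
set tau := 2 * cos th in tauE.
have tau0 : 0 < tau by rewrite mulr_gt0.
have tau1 : tau < 2 / 3 by nra.
have tau2 : 1 / 2 < tau by nra.
have [k /andP[qle qgt]] : exists k : nat, (1 + tau) ^+ k <= p / 100 < (1 + tau) ^+ k.+1.
  by apply: exp_bracket; lra.
have [a [b]] := golden_inhomogeneous tau k (N / 5) (2 * N / 5) tau0 tauE.
set x := a%:~R - _; set y := b%:~R - _ => /=.
set q := (1 + tau) ^+ k in qle qgt *.
have q1 : 1 <= q by rewrite exprn_ege1//; lra.
have {qgt} qgt : p <= 200 * q.
  by move: qgt; rewrite exprS -/q => ?; nra.
set u := x + tau * y; set v := x - _ * y => -[u1 u5 v5].
pose t : R := 2 * pi / N.
have t0 : 0 < t by rewrite divr_gt0// mulr_gt0// pi_gt0.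
have tN : t * N <= 8 by rewrite divfK ?gt_eqF//; have := @pihalf_lt2 R; lra.
(* Cubing [q <= p / 100] gives [10 ^ 6 * q ^ 3 <= N]; this smallness makes the quadratic error
   negligible. *)
have tq3 : 10 ^+ 6 * (t * q ^+ 3) <= 8.
  apply: le_trans tN; rewrite -pE mulrCA ler_pM2l//.
  have : q ^+ 3 <= (p / 100) ^+ 3 by rewrite lerXn2r ?nnegrE//; lra.
  by rewrite exprMn exprVn; lra.
have u5' : `|u| <= 5 * q.
  by have := normr_ge0 u; nra.
have yle : `|y| <= 5 * q.
  (* Both conjugates are [O(q)], hence so are the coordinates. *)
  have -> : y = (u - v) / (1 + 2 * tau) by rewrite /u /v; field; lra.
  rewrite normrM normfV [`|1 + _|]gtr0_norm; last lra.
  rewrite ler_pdivrMr; last lra.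
  by have := ler_normB u v; nra.
have xle : `|x| <= 10 * q.
  have -> : x = u - tau * y by rewrite /u; ring.
  have := ler_normB u (tau * y); rewrite normrM [`|tau|]gtr0_norm//.
  by have := normr_ge0 y; nra.
have xy : x ^+ 2 + y ^+ 2 <= 125 * q ^+ 2.
  rewrite -(real_normK (num_real x)) -(real_normK (num_real y)).
  by have := normr_ge0 x; have := normr_ge0 y; nra.
have := @pentagon_perturbation R t x y; rewrite /= -/th -/tau -/u.
have -> : th + t * x = 2 * pi * a%:~R / N.
  by rewrite /th /t /x; field; rewrite gt_eqF.
have -> : 2 * th + t * y = 2 * pi * b%:~R / N.
  by rewrite /th /t /y; field; rewrite gt_eqF.
have := @min_rootsum5_symmetric R n a b n0; rewrite /= -/N.
set F := 1 + _ + _ => Fmin Ferr.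
have q0 : 0 < q by lra.
have errle : q * (2 * t ^+ 2 * (x ^+ 2 + y ^+ 2)) <= t / 100.
  have h : q * (2 * t ^+ 2 * (x ^+ 2 + y ^+ 2)) <= q * (2 * t ^+ 2 * (125 * q ^+ 2)).
    by rewrite ler_pM2l// ler_pM2l// mulr_gt0// exprn_gt0.
  apply: (le_trans h).
  have -> : q * (2 * t ^+ 2 * (125 * q ^+ 2)) = t * (250 * (t * q ^+ 3)) by ring.
  by rewrite ler_pM2l//; lra.
(* [- G] is the linear term of [F]. As [q * |G|] lies between [t] and [10 * t] and the error is at
   most [t / 100], [F] is nonzero and [q * |F| <= 11 * t]. *)
pose G := 2 * t * sin th * u.
have GE : q * `|G| = 2 * sin th * (t * (q * `|u|)).
  have s0 : 0 < sin th by lra.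
  by rewrite /G 3!normrM normr_nat (gtr0_norm t0) (gtr0_norm s0); ring.
have G_ge : t <= q * `|G|.
  have h : t <= t * (q * `|u|) by rewrite ler_peMr// ltW.
  by rewrite GE; nra.
have G_le : q * `|G| <= 10 * t.
  have h : t * (q * `|u|) <= t * 5 by rewrite ler_pM2l.
  have h0 : 0 <= t * (q * `|u|) by rewrite mulr_ge0 ?(ltW t0)// mulr_ge0 ?(ltW q0).
  by rewrite GE; nra.
have qFG : q * `|F + G| <= t / 100.
  by apply: le_trans errle; rewrite ler_pM2l.
have F_ge : q * `|G| <= q * `|F| + q * `|F + G|.
  rewrite -mulrDr ler_pM2l//.
  by have := ler_normB (F + G) F; rewrite [F + G - F]addrAC subrr add0r addrC.
have F_le : q * `|F| <= q * `|G| + q * `|F + G|.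
  rewrite -mulrDr ler_pM2l//.
  by have := ler_normB (F + G) G; rewrite addrK addrC.
have F0 : F != 0.
  by apply/eqP => F0; move: F_ge; rewrite {1}F0 normr0 mulr0; lra.
apply: (le_trans (Fmin F0)).
rewrite ler_pdivlMr ?exprn_gt0// exprSr pE.
(* Since [p <= 200 * q] and [t * N <= 8], the product is at most [200 * 11 * 8], well below [C]. *)
have h1 : `|F| * (N * p) <= `|F| * (N * (200 * q)).
  by rewrite ler_wpM2l// ler_pM2l.
apply: (le_trans h1).
have h2 : N * (q * `|F|) <= N * (11 * t) by rewrite ler_pM2l//; lra.
by lra.
Qed.
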